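(* Let $p$ be a prime and let $a$ and $b$ be positive integers with $a<b$. The number of fixed-point-free automorphisms of $\mathbf{Z}_{p^{a}}\oplus\mathbf{Z}_{p^{b}}$ is equal to \[ \theta(\mathbf{Z}_{p^{a}}\oplus\mathbf{Z}_{p^{b}},1)=p^{3a+b-2}(p-2)^{2}. \]
   Context: $\mathbf{Z}_{n}$ denotes the (additive) group of integers modulo $n$. An automorphism of a group $G$ is called fixed-point-free if it fixes only the identity element of $G$. For a finite group $G$ and a divisor $d$ of $|G|$, $\theta(G,d)$ is the number of automorphisms $f$ of $G$ such that $|\{g\in G: f(g)=g\}|=d$; in particular $\theta(G,1)$ is the number of fixed-point-free automorphisms of $G$. *)

(* Defs.v *)
From mathcomp Require Import all_boot all_order all_algebra all_fingroup.

Set Implicit Arguments.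
Unset Strict Implicit.
Unset Printing Implicit Defensive.

Local Open Scope group_scope.

Section FixedPoints.

Variables (gT : finGroupType) (G : {group gT}).

Definition fixed_points (f : {perm gT}) : {set gT} := [set g in G | f g == g].

(* Elements of [Aut G] are permutations of the ambient type that restrict to
   an automorphism of [G] and are the identity outside [G]; they correspond
   one-to-one to the automorphisms of [G]. *)
Definition theta (d : nat) : nat := #|[set f in Aut G | #|fixed_points f| == d]|.

Definition fixed_point_free (f : {perm gT}) : bool :=
  [forall g in G, (f g == g) ==> (g == 1)].

End FixedPoints.

(* ['Z_n] is the integers modulo n only for n > 1, which holds for n = p ^ a
   with p prime and a > 0.  Its [finGroupType] structure is the additive one,
   and the product type carries the componentwise group law. *)
Definition Zsum (m n : nat) : {group 'Z_m * 'Z_n} := [set: 'Z_m * 'Z_n]%G.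

(* Main.v *)
(** Write e1 = (1, 0) and e2 = (0, 1).  An endomorphism f of Z_(p^a) + Z_(p^b)
is determined by u = f e1 and v = f e2, which are arbitrary up to p^a u = 0,
i.e. p^(b-a) divides u.2.  Since a < b, the matrix (u, v) is triangular modulo p,
so f is injective if and only if p divides neither u.1 nor v.2.  Applied to f
and to f - id, this gives: f is a fixed-point-free automorphism if and only if
u.1 and v.2 avoid the residues 0 and 1 modulo p.  There are p^(a-1) (p-2) choices
for u.1, p^a for u.2, p^a for v.1 and p^(b-1) (p-2) for v.2. *)

Require Import Defs.
From mathcomp Require Import all_boot all_order all_algebra all_fingroup.
From mathcomp Require Import zify ring.

Import GRing.Theory.

(** * Divisibility and counting in ['Z_n] *)

Lemma card_Zp_dvdn (n d : nat) : 1 < n -> d %| n ->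
  #|[set x : 'Z_n | d %| x]| = n %/ d.
Proof.
move=> n_gt1 dvd_dn; rewrite divn_count_dvd big_add1 /= -sum1_card.
transitivity (\sum_(0 <= i < n) (d %| i)).
  rewrite big_mkord -[in RHS](Zp_cast n_gt1) big_mkcond; apply: eq_bigr => x _.
  by rewrite inE; case: (d %| x).
case: n {n_gt1} dvd_dn => [|n] dvd_dn; first by rewrite !big_geq.
(* The two counts run over indices from 0 and from 1; they differ only by their end terms, 0 and the
   modulus, both divisible by [d]. *)
by rewrite big_nat_recl // [RHS]big_nat_recr //= dvdn0 dvd_dn addnC.
Qed.

Lemma Zp_mulrnD_eq0 (n : nat) (s t : 'Z_n) (x y : nat) : 1 < n ->
  ((s *+ x + t *+ y)%R == 0%R) = (n %| s * x + t * y).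
Proof.
move=> n_gt1; rewrite -[X in (X *+ x)%R]natr_Zp -[X in (X *+ y)%R]natr_Zp.
by rewrite -!mulrnA -natrD -(inj_eq val_inj) /= val_Zp_nat.
Qed.

Lemma dvdn_Zp_addr1 (n d : nat) (x : 'Z_n) : 1 < n -> d %| n ->
  (d %| (x + 1)%R) = (d %| x.+1).
Proof.
move=> n_gt1 dvd_dn.
rewrite -{1}(natr_Zp x) natr1 val_Zp_nat //.
by rewrite /dvdn modn_dvdm.
Qed.

(** The residues 0 and 1 modulo [p] exclude two disjoint classes of [p ^ k.-1] elements each, the
    second being the first translated by 1. *)
Lemma card_Zp_unit_unit (p k : nat) : prime p -> 0 < k ->
  #|[set x : 'Z_(p ^ k) | ~~ (p %| x) && ~~ (p %| (x - 1)%R)]|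
    = p ^ k.-1 * (p - 2).
Proof.
move=> p_pr k_gt0; have p_gt1 := prime_gt1 p_pr.
have q_gt1 : 1 < p ^ k by rewrite -(exp1n k) ltn_exp2r.
have dvd_pq : p %| p ^ k by rewrite dvdn_exp.
set N0 := [set x : 'Z_(p ^ k) | p %| x].
pose N1 := [set x : 'Z_(p ^ k) | p %| (x - 1)%R].
have cN0 : #|N0| = p ^ k.-1.
  by rewrite card_Zp_dvdn // -{1}(prednK k_gt0) expnSr mulnK // ltnW.
have cN1 : #|N1| = p ^ k.-1.
  rewrite -cN0 -(card_imset (mem N0) (addIr 1%R)); apply: eq_card => x.
  apply/idP/imsetP => [|[y]]; rewrite !inE.
    by exists (x - 1)%R; rewrite ?inE ?subrK.
  by move=> Ny ->; rewrite addrK.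
have dis : [disjoint N0 & N1].
  apply/pred0P => x /=; apply/negP; rewrite !inE => /andP[].
  rewrite -{1}(subrK 1%R x) dvdn_Zp_addr1 // -addn1 => h1 h2.
  by move: h1; rewrite dvdn_addr // dvdn1 => /eqP p1; rewrite p1 in p_gt1.
have -> : [set x : 'Z_(p ^ k) | ~~ (p %| x) && ~~ (p %| (x - 1)%R)]
    = ~: (N0 :|: N1).
  by apply/setP => x; rewrite !inE negb_or.
rewrite cardsCs setCK cardsU (disjoint_setI0 dis) cards0 subn0 cN0 cN1.
by rewrite card_ord Zp_cast // mulnBr -expnSr prednK // muln2 addnn.
Qed.

Lemma Zp_eq0 (q : nat) (x : 'Z_q) : 1 < q -> (x == 0%R) = (q %| x).
Proof.
by move=> q_gt1; rewrite -{1}(natr_Zp x) -(inj_eq val_inj) /= val_Zp_nat.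
Qed.

(** The candidate endomorphism sending (1, 0) to [u] and (0, 1) to [v]. The coordinates of [z] act
    through their natural representatives, so the map exists for all [u] and [v], additive or
    not. *)
Definition Zlin (m n : nat) (u v z : 'Z_m * 'Z_n) : 'Z_m * 'Z_n :=
  (u *+ z.1 + v *+ z.2)%R.

Lemma pair_mulrn (U V : nmodType) (u : U * V) (k : nat) :
  (u *+ k)%R = (u.1 *+ k, u.2 *+ k)%R.
Proof. rewrite -(raddfMn fst) -(raddfMn snd); exact: surjective_pairing. Qed.

Lemma Zp_mulrn_mod (n : nat) (t : 'Z_n) (k l : nat) : 1 < n -> n %| l ->
  (t *+ (k %% l) = t *+ k)%R.
Proof.
move=> n_gt1 dvd_nl; rewrite -[t]natr_Zp -!mulrnA.
rewrite -Zp_nat_mod // -[RHS]Zp_nat_mod //; congr (_%:R)%R.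
by rewrite -modnMmr modn_dvdm // modnMmr.
Qed.

(** * Kernels of the maps [Zlin] for prime powers *)

Section PrimePowers.

Context {p a b : nat} (p_pr : prime p) (a_gt0 : 0 < a) (a_lt_b : a < b).

Local Notation m := (p ^ a).
Local Notation n := (p ^ b).
Local Notation E := (@Zlin m n).

Let p_gt1 : 1 < p := prime_gt1 p_pr.
Let p_gt0 : 0 < p := prime_gt0 p_pr.

Let m_gt1 : 1 < m.
Proof. by rewrite -(exp1n a) ltn_exp2r. Qed.

Let n_gt1 : 1 < n.
Proof. by rewrite -(exp1n b) ltn_exp2r // (leq_trans _ a_lt_b). Qed.

Let dvd_mn : m %| n.
Proof. by rewrite dvdn_exp2l // ltnW. Qed.

Lemma Zlin_eq0 (u v z : 'Z_m * 'Z_n) :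
  (E u v z == 0%R)
    = (m %| u.1 * z.1 + v.1 * z.2) && (n %| u.2 * z.1 + v.2 * z.2).
Proof. by rewrite /Zlin !pair_mulrn -!Zp_mulrnD_eq0. Qed.

(* [u] must be killed by [m]: otherwise the map depends on representatives. *)
Lemma Zlin_nat (u v : 'Z_m * 'Z_n) (x y : nat) : (u.2 *+ m = 0)%R ->
  E u v (x%:R, y%:R)%R = (u *+ x + v *+ y)%R.
Proof.
move=> um0; rewrite /Zlin /= !val_Zp_nat //; congr (_ + _)%R.
  rewrite !pair_mulrn Zp_mulrn_mod //; congr (_, _).
  by rewrite [in RHS](divn_eq x m) mulrnDr mulnC mulrnA um0 mul0rn add0r.
by rewrite !pair_mulrn !Zp_mulrn_mod.
Qed.

Lemma ZlinD (u v : 'Z_m * 'Z_n) : (u.2 *+ m = 0)%R ->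
  {morph E u v : z t / (z + t)%R}.
Proof.
move=> um0 [x y] [x' y'].
have -> : ((x, y) + (x', y') = ((x + x')%N%:R, (y + y')%N%:R) :> 'Z_m * 'Z_n)%R.
  by rewrite !natrD !natr_Zp.
by rewrite Zlin_nat // /Zlin /= !mulrnDr addrACA.
Qed.

(** The two congruences feed each other: divisibility of [y] improves that of [x] through the first,
    which in turn improves that of [y] through the second. *)
Lemma dvdn_triangular (r s c d x y : nat) :
    ~~ (p %| r) -> ~~ (p %| d) -> p ^ (b - a) %| c ->
  m %| r * x + s * y -> n %| c * x + d * y -> m %| x /\ n %| y.
Proof.
move=> r_p d_p dvd_c H1 H2.
have cop e w : ~~ (p %| w) -> coprime (p ^ e) w.
  by move=> w_p; rewrite coprimeXl // prime_coprime.
(* The exponent for [y] stays ahead by [b - a > 0], so [s * y] already has the next power of [p]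
   needed for [x]; the factor [p ^ (b - a)] of [c] then restores the lead. *)
suff H j : j <= a -> p ^ j %| x /\ p ^ (b - a + j) %| y.
  by have := H a (leqnn a); rewrite subnK // ltnW.
elim: j => [_|j IHj lt_ja].
  split; first exact: dvd1n.
  rewrite addn0 -(Gauss_dvdr _ (cop _ _ d_p)).
  rewrite -(dvdn_addr _ (dvdn_mulr x dvd_c)).
  by apply: dvdn_trans H2; rewrite dvdn_exp2l // leq_subr.
have [dvd_x dvd_y] := IHj (ltnW lt_ja).
have dvd_x' : p ^ j.+1 %| x.
  rewrite -(Gauss_dvdr _ (cop _ _ r_p)) -(dvdn_addl (n := s * y)).
    by apply: dvdn_trans H1; rewrite dvdn_exp2l.
  apply: dvdn_mull; apply: dvdn_trans dvd_y; rewrite dvdn_exp2l //.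
  by rewrite -add1n leq_add2r subn_gt0.
split=> //; rewrite -(Gauss_dvdr _ (cop _ _ d_p)) -(dvdn_addr (m := c * x)).
  apply: dvdn_trans H2; rewrite dvdn_exp2l //.
  by rewrite -[leqRHS](subnK (ltnW a_lt_b)) leq_add2l.
by rewrite expnD dvdn_mul.
Qed.

Lemma Zp_mulrn_eq0 (c : 'Z_n) : (c *+ m == 0)%R = (p ^ (b - a) %| c).
Proof.
rewrite -[(c *+ m)%R]addr0 -(mul0rn _ 0) Zp_mulrnD_eq0 // addn0.
rewrite -{1}(subnK (ltnW a_lt_b)) expnD dvdn_pmul2r //.
by rewrite expn_gt0 p_gt0.
Qed.

(** Sufficiency is [dvdn_triangular]; for necessity, each failing condition yields an explicit
    nonzero element of the kernel. *)
Lemma Zlin_ker0 (u v : 'Z_m * 'Z_n) : (u.2 *+ m = 0)%R ->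
  [forall z, (E u v z == 0%R) ==> (z == 0%R)] = ~~ (p %| u.1) && ~~ (p %| v.2).
Proof.
move=> um0; have /eqP := um0; rewrite Zp_mulrn_eq0 => dvd_c.
apply/forallP/andP => [ker0 | [u_p v_p] z]; last first.
  rewrite Zlin_eq0; apply/implyP => /andP[H1 H2].
  have [] := dvdn_triangular _ _ _ _ _ _ u_p v_p dvd_c H1 H2.
  by case: z {H1 H2} => x y /=; rewrite -!Zp_eq0 // => /eqP-> /eqP->.
have ker0n x y : (u *+ x + v *+ y = 0)%R -> (m %| x) && (n %| y).
  move=> H0; have /implyP := ker0 (x%:R, y%:R)%R; rewrite Zlin_nat // H0 eqxx.
  case/(_ isT)/eqP => /(congr1 val) /= + /(congr1 val) /=.
  by rewrite !val_Zp_nat // /dvdn => -> ->.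
have lin0 x y : m %| u.1 * x + v.1 * y -> n %| u.2 * x + v.2 * y ->
    (m %| x) && (n %| y).
  move=> H1 H2; apply: ker0n; rewrite !pair_mulrn; congr (_, _); apply/eqP.
    by rewrite Zp_mulrnD_eq0.
  by rewrite Zp_mulrnD_eq0.
have not_dvd k : 0 < k -> (p ^ k %| p ^ k.-1) = false.
  by move=> k_gt0; rewrite dvdn_Pexp2l // -ltnS prednK // ltnn.
have b_gt0 : 0 < b by apply: leq_trans a_lt_b.
have le_ab1 : a <= b.-1 by rewrite -ltnS prednK.
(* If [p] divides [v.2], then (0, p^(b-1)) is killed; its first image coordinate vanishes because
   [a <= b.-1]. This case comes first because the witness for [u.1] is shown nonzero using that
   [v.2] is prime to [p]. *)
have v_p : ~~ (p %| v.2).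
  apply/negP => v_p; have [||] := andP (lin0 0 (p ^ b.-1) _ _).
  - by rewrite muln0 dvdn_mull // dvdn_exp2l.
  - by rewrite muln0 -{1}(prednK b_gt0) expnS dvdn_mul.
  by rewrite not_dvd.
split=> //; apply/negP => u_p.
(* [(v.2 p^(a-1), - g p^(b-1))] is killed; [p - 1] stands for [-1]. *)
have [g cE] := dvdnP dvd_c.
have [||] := andP (lin0 (v.2 * p ^ a.-1) (p.-1 * g * p ^ b.-1) _ _).
- rewrite dvdn_add //; last by rewrite !dvdn_mull // dvdn_exp2l.
  by rewrite mulnCA dvdn_mull // -{1}(prednK a_gt0) expnS dvdn_mul.
- have E1 : p ^ (b - a) * p ^ a.-1 = p ^ b.-1.
    rewrite -expnD; congr (_ ^ _).
    by apply: succn_inj; rewrite -addnS !prednK // subnK // ltnW.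
  have -> : u.2 * (v.2 * p ^ a.-1) + v.2 * (p.-1 * g * p ^ b.-1)
      = v.2 * g * (p.-1.+1 * p ^ b.-1).
    rewrite cE -E1 mulSn !mulnDr; congr (_ + _).
      by rewrite mulnCA -!mulnA.
    by rewrite -!mulnA; congr (_ * _); rewrite mulnCA.
  by rewrite prednK // -expnS prednK // dvdn_mull.
rewrite Gauss_dvdr ?not_dvd //.
by rewrite coprimeXl // prime_coprime.
Qed.

(** * Automorphisms and their fixed points *)

Local Notation e1 := ((1, 0)%R : 'Z_m * 'Z_n).
Local Notation e2 := ((0, 1)%R : 'Z_m * 'Z_n).
Local Notation G := (Zsum m n).

Lemma Zlin_id (z : 'Z_m * 'Z_n) : E e1 e2 z = z.
Proof.
case: z => x y; rewrite /Zlin !pair_mulrn /= !mul0rn !natr_Zp.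
by congr (_, _); rewrite ?addr0 ?add0r.
Qed.

(** Turns the fixed points of a map into the kernel of another [Zlin], to which [Zlin_ker0]
    applies. *)
Lemma ZlinB (u v z : 'Z_m * 'Z_n) : (E u v z - z = E (u - e1) (v - e2) z)%R.
Proof. by rewrite -{2}(Zlin_id z) /Zlin !mulrnBl opprD addrACA. Qed.

Lemma Aut_ZlinE (f : {perm 'Z_m * 'Z_n}) : f \in Aut G ->
  f =1 E (f e1) (f e2) /\ ((f e1).2 *+ m = 0)%R.
Proof.
move=> Af; have fM x y : f (x + y)%R = (f x + f y)%R.
  by have := morphM (autm_morphism Af) (in_setT x) (in_setT y); rewrite /= autmE.
have f0 : f 0%R = 0%R by apply: (addrI (f 0%R)); rewrite -fM !addr0.
have fX x k : f (x *+ k)%R = (f x *+ k)%R.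
  by elim: k => [|k IHk]; rewrite ?mulr0n // !mulrS fM IHk.
split=> [z|]; first by rewrite -{1}(Zlin_id z) /Zlin fM !fX.
have : f (e1 *+ m)%R = 0%R.
  by rewrite pair_mulrn /= mul0rn pchar_Zp.
by rewrite fX pair_mulrn => -[].
Qed.

Lemma Zlin_Aut (u v : 'Z_m * 'Z_n) : (u.2 *+ m = 0)%R ->
    ~~ (p %| u.1) -> ~~ (p %| v.2) ->
  exists2 f : {perm 'Z_m * 'Z_n}, f \in Aut G & f =1 E u v.
Proof.
move=> um0 u_p v_p.
have injE : injective (E u v).
  move=> z t eq_zt; apply/eqP; rewrite -subr_eq0.
  have /forallP ker0 : [forall z, (E u v z == 0%R) ==> (z == 0%R)].
    by rewrite Zlin_ker0 // u_p.
  apply: (implyP (ker0 _)); apply/eqP/(addIr (E u v t)).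
  by rewrite -ZlinD // subrK add0r.
exists (perm injE); last exact: permE.
rewrite inE; apply/andP; split; first by apply/subsetP => z _; rewrite inE.
by apply/morphicP => z t _ _; rewrite !permE ZlinD.
Qed.

Lemma fixed_point_free_Zlin (f : {perm 'Z_m * 'Z_n}) (u v : 'Z_m * 'Z_n) :
    (u.2 *+ m = 0)%R -> f =1 E u v ->
  fixed_point_free G f = ~~ (p %| (u.1 - 1)%R) && ~~ (p %| (v.2 - 1)%R).
Proof.
(* Subtracting [e1] leaves [u.2] unchanged, so the condition on it carries over. *)
move=> um0 fE; have um0' : ((u - e1)%R.2 *+ m = 0)%R by rewrite /= subr0.
rewrite -(Zlin_ker0 _ (v - e2)%R um0').
by apply: eq_forallb => z; rewrite inE -ZlinB fE subr_eq0.
Qed.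

(** The images of [e1] and [e2] determine an automorphism, and the constraints on their four
    coordinates are independent, hence a product. *)
Lemma card_fixed_point_free_Aut :
  #|[set f in Aut G | fixed_point_free G f]|
    = (p ^ a.-1 * (p - 2) * m) * (m * (p ^ b.-1 * (p - 2))).
Proof.
have b_gt0 : 0 < b by apply: leq_trans a_lt_b.
pose A k := [set x : 'Z_(p ^ k) | ~~ (p %| x) && ~~ (p %| (x - 1)%R)].
pose C := [set c : 'Z_n | p ^ (b - a) %| c].
pose images (f : {perm 'Z_m * 'Z_n}) := (f e1, f e2).
rewrite -(card_in_imset (f := images)); last first.
  move=> f g /setIdP[/Aut_ZlinE[fE _] _] /setIdP[/Aut_ZlinE[gE _] _] [eq1 eq2].
  by apply/permP => z; rewrite fE gE eq1 eq2.
have -> : [set images f | f in [set f in Aut G | fixed_point_free G f]]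
    = setX (setX (A a) C) (setX setT (A b)).
  apply/setP => -[u v]; apply/imsetP/idP => [[f] | ].
    case/setIdP=> Af fpf [-> ->]; have [fE um0] := Aut_ZlinE f Af.
    have := fpf; rewrite (fixed_point_free_Zlin _ _ _ um0 fE) => /andP[u1 v1].
    have : [forall z, (E (f e1) (f e2) z == 0%R) ==> (z == 0%R)].
      apply/forallP => z; rewrite -fE; apply/implyP => /eqP fz0.
      have f0 : f 0%R = 0%R by rewrite fE /Zlin !mulr0n addr0.
      by apply/eqP/(@perm_inj _ f); rewrite f0.
    rewrite Zlin_ker0 // => /andP[u0 v0].
    by rewrite !inE /= u0 u1 v0 v1 -Zp_mulrn_eq0 um0 eqxx.
  rewrite !inE /= => /andP[/andP[/andP[u0 u1] uC] /andP[v0 v1]].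
  have um0 : (u.2 *+ m = 0)%R by apply/eqP; rewrite Zp_mulrn_eq0.
  have [f Af fE] := Zlin_Aut _ v um0 u0 v0.
  exists f; first by apply/setIdP; rewrite (fixed_point_free_Zlin _ _ _ um0 fE) u1.
  rewrite /images !fE; congr (_, _).
    by rewrite [RHS](Zlin_nat u v 1 0 um0) mulr1n mulr0n addr0.
  by rewrite [RHS](Zlin_nat u v 0 1 um0) mulr1n mulr0n add0r.
rewrite !cardsX cardsT !card_Zp_unit_unit //.
rewrite card_Zp_dvdn ?dvdn_exp2l ?leq_subr //.
by rewrite card_ord Zp_cast // -expnB ?leq_subr // subKn // ltnW.
Qed.

End PrimePowers.

(** The identity is always fixed, so a lone fixed point must be the identity. *)
Lemma fixed_points_card1 (gT : finGroupType) (G : {group gT}) (f : {perm gT}) :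
  f \in Aut G -> fixed_point_free G f = (#|fixed_points G f| == 1).
Proof.
move=> Af; have f1 : f 1%g = 1%g.
  by have := morph1 (autm_morphism Af); rewrite /= autmE.
have in1 : 1%g \in fixed_points G f by rewrite inE group1 f1 eqxx.
apply/forall_inP/cards1P => [fpf | [x xE] g Gg].
  exists 1%g; apply/setP => g; rewrite !inE.
  apply/andP/eqP => [[Gg fg] | ->]; first exact/eqP/(implyP (fpf g Gg)).
  by rewrite group1 f1.
apply/implyP => fg; have : g \in fixed_points G f by rewrite inE Gg.
by move: in1; rewrite xE !inE => /eqP->.
Qed.

Theorem proposition4p1 (p a b : nat) (p_prime : prime p)
    (a_gt0 : 0 < a) (b_gt0 : 0 < b) (a_lt_b : a < b) :
  let G := Zsum (p ^ a) (p ^ b) in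
  #|[set f in Aut G | fixed_point_free G f]| = theta G 1 /\
  theta G 1 = p ^ (3 * a + b - 2) * (p - 2) ^ 2.
Proof.
move=> G.
have eq_theta : #|[set f in Aut G | fixed_point_free G f]| = theta G 1.
  apply: eq_card => f; apply/setIdP/setIdP => -[Af].
    by rewrite fixed_points_card1.
  by rewrite -fixed_points_card1.
split=> //; rewrite -eq_theta (card_fixed_point_free_Aut p_prime a_gt0 a_lt_b).
(* As [a] and [b] are positive, no subtraction here is truncated. *)
have -> : 3 * a + b - 2 = a.-1 + a + (a + b.-1) by lia.
by rewrite !expnD -mulnn; ring.
Qed.
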